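(* Let $F\subset\mathbb R^m$ be a closed, bounded, convex set containing the origin as an interior point, let $n\ge2$, and let $\Omega,\Omega_1,\dots,\Omega_n$ be nonempty closed convex subsets of the Euclidean space $\mathbb R^m$. Consider the problem $$(P)\qquad\text{minimize }T(x):=\sum_{i=1}^nT^F_{\Omega_i}(x)\quad\text{subject to }x\in\Omega,$$ and let $S\neq\emptyset$ be its set of optimal solutions. Picking a sequence $\{\alpha_k\}_{k\in\mathbb N}$ of positive numbers and a starting point $x_1\in\Omega$, consider the algorithm $$x_{k+1}=\Pi\Big(x_k-\alpha_k\sum_{i=1}^nq_{ik};\Omega\Big),\quad k=1,2,\dots,$$ with an arbitrary choice of vectors $$q_{ik}\in-\partial\rho_F(\omega_{ik}-x_k)\cap N(\omega_{ik};\Omega_i)\quad\text{for some }\omega_{ik}\in\Pi^F_{\Omega_i}(x_k)\quad\text{if }x_k\notin\Omega_i$$ and with $q_{ik}:=0$ otherwise. Assume that $$\sum_{k=1}^\infty\alpha_k=\infty\quad\text{and}\quad\sum_{k=1}^\infty\alpha_k^2<\infty .$$ Then the iterative sequence $\{x_k\}$ converges to an optimal solution of $(P)$, and the value sequence $$V_k:=\min\{T(x_j): j=1,\dots,k\}$$ converges to the optimal value $\widehat V$ of $(P)$. Furthermore, for all $k\in\mathbb N$, $$V_k-\widehat V\le\frac{d(x_1;S)^2+L^2\sum_{i=1}^k\alpha_i^2}{2\sum_{i=1}^k\alpha_i},$$ where $0\le L<\infty$ is a Lipschitz constant of the function $T(\cdot)$ on $\mathbb R^m$.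
   Context: $T^F_Q(x):=\inf\{t\ge0:Q\cap(x+tF)\neq\emptyset\}$ is the minimal time function; $\Pi^F_Q(x):=Q\cap(x+T^F_Q(x)F)$ is the generalized projection; $\rho_F(x):=\inf\{t\ge0:x\in tF\}$ is the Minkowski gauge and $\partial\rho_F$ its subdifferential in the sense of convex analysis. $N(\omega;Q)=\{v:\langle v,x-\omega\rangle\le0\ \forall x\in Q\}$ is the normal cone of a convex set $Q$ at $\omega\in Q$. $\Pi(x;\Omega)$ is the unique Euclidean projection of $x$ onto $\Omega$, and $d(x;S)$ is the Euclidean distance from $x$ to $S$. *)

(* Defs.v *)
From HB Require Import structures.
From mathcomp Require Import all_boot all_order all_algebra.
From mathcomp Require Import all_classical all_reals all_analysis.

Set Implicit Arguments.
Unset Strict Implicit.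
Unset Printing Implicit Defensive.

Import Order.TTheory GRing.Theory Num.Theory.
Import numFieldNormedType.Exports.

Local Open Scope classical_set_scope.
Local Open Scope ring_scope.

Section minimal_time.
Context {R : realType} {m : nat}.
Implicit Types (x y u v w p : 'rV[R]_m) (F Q A : set 'rV[R]_m).

(* The library norm on 'rV[R]_m is the sup norm: it induces the right topology
   and the right bounded sets, but the Euclidean metric has to be defined. *)
Definition dotv u v : R := \sum_(i < m) u ord0 i * v ord0 i.

Definition enorm u : R := Num.sqrt (dotv u u).

Definition dist_to x A : R := inf [set enorm (x - y) | y in A].

Definition is_eproj A x p : Prop :=
  A p /\ forall y, A y -> enorm (x - p) <= enorm (x - y).

(* The chosen point exists and is unique when A is nonempty, closed and convex;
   otherwise the value may be arbitrary. *)
Definition eproj x A : 'rV[R]_m := get [set p | is_eproj A x p].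

Definition dilate (t : R) F : set 'rV[R]_m := [set t *: u | u in F].

Definition translate x A : set 'rV[R]_m := [set x + u | u in A].

(* The infimum is over a nonempty set bounded below by 0 whenever Q is nonempty
   and F is a neighborhood of the origin. *)
Definition min_time F Q x : R :=
  inf [set t : R | 0 <= t /\ Q `&` translate x (dilate t F) !=set0].

Definition gproj F Q x : set 'rV[R]_m :=
  Q `&` translate x (dilate (min_time F Q x) F).

Definition gauge_fun F x : R := inf [set t : R | 0 <= t /\ dilate t F x].

Definition subdiff (f : 'rV[R]_m -> R) x : set 'rV[R]_m :=
  [set v | forall y, dotv v (y - x) <= f y - f x].

Definition normal_cone w Q : set 'rV[R]_m :=
  [set v | forall x, Q x -> dotv v (x - w) <= 0].

Definition total_time F n (Om : 'I_n -> set 'rV[R]_m) x : R :=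
  \sum_(i < n) min_time F (Om i) x.

Definition minimizers (T : 'rV[R]_m -> R) A : set 'rV[R]_m :=
  [set x | A x /\ forall y, A y -> T x <= T y].

Definition optimal_value (T : 'rV[R]_m -> R) A : R := inf [set T x | x in A].

Definition is_lipschitz_const (L : R) (T : 'rV[R]_m -> R) : Prop :=
  0 <= L /\ forall x y, `|T x - T y| <= L * enorm (x - y).

Definition admissible F Q x : set 'rV[R]_m :=
  [set q | (~ Q x -> exists w, gproj F Q x w /\
              ((-%R @` subdiff (gauge_fun F) (w - x)) `&` normal_cone w Q) q)
           /\ (Q x -> q = 0)].

(* Indices start at 1; best_value T x 0 = T (x 1) is a junk value. *)
Definition best_value (T : 'rV[R]_m -> R) (x : nat -> 'rV[R]_m) (k : nat) : R :=
  \big[Num.min/T (x 1%N)]_(1 <= j < k.+1) T (x j).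

End minimal_time.

(* Main.v *)
Require Import Defs.
From HB Require Import structures.
From mathcomp Require Import all_boot all_order all_algebra.
From mathcomp Require Import all_classical all_reals all_analysis.
From mathcomp Require Import ring lra.
Import Order.TTheory GRing.Theory Num.Theory.
Import numFieldNormedType.Exports.
Local Open Scope classical_set_scope.
Local Open Scope ring_scope.

(** The sum [q_k] of the chosen vectors is a subgradient at [x_k] of the total
    time [T], so the algorithm is a projected subgradient method, and its
    standard analysis applies.

    Subgradients ([admissible_subdiff]): let [q = - v], where [v] is a
    subgradient of the gauge at [w - x] and [q] is normal to [Q] at [w]. If
    [p] in [Q] is reached from [y] in time [t], then [p - y] lies in [t F], so
    [t >= gauge (p - y) >= gauge (w - x) + <v, (p - y) - (w - x)>].
    Here [gauge (w - x)] is at least the minimal time from [x], and the inner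
    product is [<v, p - w> + <q, y - x>], where [<v, p - w> >= 0] by
    normality. Taking the infimum over [t] gives the subgradient inequality.

    Lipschitz bound ([min_time_lipschitz]): as [F] contains a ball around the
    origin, [y] is reached from [x] in a time proportional to the distance
    between them, and by convexity of [F] a trip from [x] to [y] followed by a
    trip from [y] to [Q] is a single trip whose duration is the sum of both. A
    subgradient is then bounded by any Lipschitz constant [L] of [T]
    ([subdiff_enorm_le]).

    Method: as projecting onto a convex set brings a point closer to every [y]
    of that set ([eproj_contract]), each step satisfies
    [|x_{k+1} - y|^2 + 2 a_k (T x_k - T y) <= |x_k - y|^2 + L^2 a_k^2]
    ([subgradient_step]). Summing and taking [y] optimal gives the rate. As
    [sum a_k] diverges and [sum a_k^2] converges, the summed inequality also
    prevents [T x_k] from staying away from the optimal value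
    ([frequently_near_optimal]), whence the convergence of the best values, and
    it bounds the iterates. So a subsequence with values tending to the optimum
    has a cluster point [p], which is optimal by continuity
    ([minimizer_cluster]). With [y = p] the inequality says that the squared
    distance to [p] never increases later by more than the tail of
    [L^2 sum a_k^2]; being small infinitely often, it tends to [0]
    ([iterate_cvg]). *)

Set Implicit Arguments.
Unset Strict Implicit.

(** * The Euclidean norm of row vectors *)

Section Euclid.
Context {R : realType} {m : nat}.
Implicit Types (x y u v w p : 'rV[R]_m) (A : set 'rV[R]_m).

Lemma dotvC u v : dotv u v = dotv v u.
Proof. by apply: eq_bigr => i _; rewrite mulrC. Qed.

Lemma dotvDl u v w : dotv (u + v) w = dotv u w + dotv v w.
Proof. by rewrite -big_split; apply: eq_bigr => i _; rewrite mxE mulrDl. Qed.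

Lemma dotvZl a u w : dotv (a *: u) w = a * dotv u w.
Proof. by rewrite mulr_sumr; apply: eq_bigr => i _; rewrite mxE mulrA. Qed.

Lemma dotvNl u w : dotv (- u) w = - dotv u w.
Proof. by rewrite -scaleN1r dotvZl mulN1r. Qed.

Lemma dot0v w : dotv 0 w = 0.
Proof. by rewrite -(scale0r w) dotvZl mul0r. Qed.

Lemma dotvDr u v w : dotv w (u + v) = dotv w u + dotv w v.
Proof. by rewrite dotvC dotvDl !(dotvC _ w). Qed.

Lemma dotvZr a u w : dotv w (a *: u) = a * dotv w u.
Proof. by rewrite dotvC dotvZl dotvC. Qed.

Lemma dotvNr u w : dotv w (- u) = - dotv w u.
Proof. by rewrite dotvC dotvNl dotvC. Qed.

Lemma dotv_suml n (f : 'I_n -> 'rV[R]_m) w :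
  dotv (\sum_i f i) w = \sum_i dotv (f i) w.
Proof.
by apply: (big_morph (fun u => dotv u w)) => [u v|]; rewrite ?dotvDl ?dot0v.
Qed.

Lemma sqr_enorm u : enorm u ^+ 2 = dotv u u.
Proof. by rewrite sqr_sqrtr// sumr_ge0// => i _; rewrite -expr2 sqr_ge0. Qed.

Lemma enorm_ge0 u : 0 <= enorm u.
Proof. exact: sqrtr_ge0. Qed.

Lemma enormN u : enorm (- u) = enorm u.
Proof. by rewrite /enorm dotvNl dotvNr opprK. Qed.

Lemma enorm_distC u v : enorm (u - v) = enorm (v - u).
Proof. by rewrite -enormN opprB. Qed.

Lemma sqr_enormD u v :
  enorm (u + v) ^+ 2 = enorm u ^+ 2 + 2 * dotv u v + enorm v ^+ 2.
Proof. by rewrite !sqr_enorm dotvDl !dotvDr (dotvC v u); ring. Qed.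

(** With [enorm_le_norm], lets Euclidean estimates be read in the topology, which
    is that of the sup norm. *)
Lemma norm_le_enorm u : `|u| <= enorm u.
Proof.
rewrite /Num.norm/= mx_normrE; apply/bigmax_leP; split; first exact: enorm_ge0.
move=> [i j] _ /=; rewrite ord1 -(@ler_pXn2r _ 2)// ?nnegrE ?enorm_ge0//.
rewrite sqr_enorm real_normK ?num_real// /dotv (bigD1 j)//= expr2 lerDl.
by rewrite sumr_ge0// => k _; rewrite -expr2 sqr_ge0.
Qed.

Lemma enorm_le_norm u : enorm u <= Num.sqrt m%:R * `|u|.
Proof.
rewrite -(@ler_pXn2r _ 2)// ?nnegrE ?enorm_ge0 ?mulr_ge0 ?sqrtr_ge0//.
rewrite sqr_enorm exprMn sqr_sqrtr ?ler0n// mulr_natl -[m in _ *+ m]card_ord.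
rewrite -sumr_const; apply: ler_sum => i _; rewrite -expr2 -real_normK ?num_real//.
rewrite ler_pXn2r ?nnegrE// [leRHS]/Num.norm/= mx_normrE.
exact: (le_bigmax _ (fun ij : 'I_1 * 'I_m => `|u ij.1 ij.2|) (ord0, i)).
Qed.

Lemma continuous_enorm_dist x : continuous (fun y => enorm (x - y)).
Proof.
suff c : continuous (fun y => dotv (x - y) (x - y)).
  move=> y; apply: (continuous_comp (f := fun y => dotv (x - y) (x - y))).
    exact: c.
  exact: sqrt_continuous.
apply: continuous_big => [|i _ y]; first exact: add_continuous.
have ci : {for y, continuous (fun z : 'rV[R]_m => (x - z) ord0 i)}.
  have -> : (fun z => (x - z) ord0 i) = (fun z => x ord0 i - z ord0 i).
    by apply/funext => z; rewrite !mxE.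
  by apply: continuousB; [exact: cst_continuous|exact: coord_continuous].
exact: continuousM.
Qed.

End Euclid.

(** * Euclidean projection onto a closed convex set *)

Section Convex.
Context {R : realType} {m : nat}.
Implicit Types (x y u v w p : 'rV[R]_m) (A F : set 'rV[R]_m).

(** The factor [a + b] in place of a normalisation also covers [a = b = 0],
    which spares a case distinction when displacements are composed. *)
Lemma convex_set_combine A u v (a b : R) : convex_set A -> A u -> A v ->
  0 <= a -> 0 <= b -> exists2 w, A w & a *: u + b *: v = (a + b) *: w.
Proof.
move=> cA Au Av a0 b0.
have [ab0|ab0] := eqVneq (a + b) 0.
  have [-> ->] : a = 0 /\ b = 0 by split; lra.
  by exists u => //; rewrite addr0 !scale0r addr0.
have abp : 0 < a + b by rewrite lt_neqAle eq_sym ab0 addr_ge0.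
have t0 : 0 <= a / (a + b) by rewrite divr_ge0// ltW.
have t1 : a / (a + b) <= 1 by rewrite ler_pdivrMr// mul1r lerDl.
have := cA u v (Itv01 t0 t1); rewrite !inE => /(_ Au Av) Aw.
eexists; first exact: Aw.
rewrite /conv/= scalerDr !scalerA /unstable.onem mulrBr mulr1.
have -> : (a + b) * (a / (a + b)) = a by rewrite mulrC divfK.
by rewrite [a + b]addrC addrK.
Qed.

(** Provides the compactness both for the existence of projections and for
    cluster points of the iterates. *)
Lemma compact_closed_eball A x (r : R) : closed A ->
  compact (A `&` (fun y => enorm (x - y)) @^-1` [set s : R | s <= r]).
Proof.
move=> clA; apply: bounded_closed_compact.
  exists (`|x| + r); split; first exact: num_real.
  move=> s /ltW rs y [_ /= yr]; apply: le_trans rs.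
  rewrite -[y](subKr x) (le_trans (ler_normB _ _))// lerD2l.
  exact: le_trans (norm_le_enorm _) yr.
apply: closedI => //; apply: closed_comp => [y _|]; last exact: closed_le.
exact: continuous_enorm_dist.
Qed.

(** The distance to [x] attains its minimum on the part of [A] that is no
    farther than some fixed point of [A], which is compact. *)
Lemma eprojP A x : A !=set0 -> closed A -> is_eproj A x (eproj x A).
Proof.
move=> [a Aa] clA.
suff [p pP] : exists p, is_eproj A x p by apply: (@getPex _ (is_eproj A x)); exists p.
have cK := @compact_closed_eball A x (enorm (x - a)) clA.
have [||p] := @EVT_min_rV _ _ (fun y => enorm (x - y)) _ _ cK.
- by exists a; split => /=.
- exact/continuous_subspaceT/continuous_enorm_dist.
rewrite inE => -[Ap pa] pmin; exists p; split => // y Ay.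
have [xya|/ltW xay] := leP (enorm (x - y)) (enorm (x - a)).
  by apply: pmin; rewrite inE.
exact: le_trans xay.
Qed.

(** Moving from [p] towards [y] by a fraction [t] changes the squared distance
    to [x] by [- 2 t <x - p, y - p> + t^2 |y - p|^2]; for [p] to be nearest
    this must be nonnegative for all small [t]. *)
Lemma is_eproj_dotv_le0 A x p y : convex_set A -> is_eproj A x p -> A y ->
  dotv (x - p) (y - p) <= 0.
Proof.
move=> cA [Ap pmin] Ay; set c := dotv _ _; set d := enorm (y - p) ^+ 2.
have h t : 0 < t -> t <= 1 -> 2 * c <= t * d.
  move=> t0 t1; have t1' : 0 <= 1 - t by lra.
  have [w Aw] := convex_set_combine cA Ay Ap (ltW t0) t1'.
  rewrite subrKC scale1r => e.
  have := pmin _ Aw; rewrite -(@ler_pXn2r _ 2)// ?nnegrE ?enorm_ge0//.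
  rewrite (_ : x - w = (x - p) + (- t) *: (y - p)); last first.
    rewrite -e; apply/rowP => i; rewrite !mxE; ring.
  rewrite (sqr_enormD (x - p)) (sqr_enorm (_ *: _)) !(dotvZl, dotvZr).
  rewrite -sqr_enorm -/c -/d => k; rewrite -(ler_pM2l t0); nra.
rewrite leNgt; apply/negP => c0.
have d0 : 0 <= d by exact: sqr_ge0.
have := h 1 ltr01 (lexx _) => h1.
have dc : 0 < d by lra.
(* At [t = c / d] the bound reads [2 c <= c], against [0 < c]; the case
   [t = 1] gives [2 c <= d], hence [c / d <= 1]. *)
have := h (c / d) (divr_gt0 c0 dc); rewrite divfK ?gt_eqF// ler_pdivrMr//.
lra.
Qed.

(** The angle at the projection is obtuse, so the third side of the triangle
    [x], [eproj x A], [y] is the longest. *)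
Lemma eproj_contract A x y : A !=set0 -> closed A -> convex_set A -> A y ->
  enorm (eproj x A - y) ^+ 2 <= enorm (x - y) ^+ 2.
Proof.
move=> A0 clA cA Ay; have pP := eprojP x A0 clA.
have := is_eproj_dotv_le0 cA pP Ay.
set p := eproj x A; rewrite -[y - p]opprB dotvNr oppr_le0 => h.
rewrite -[x - y](subrKA p) (sqr_enormD (x - p)).
have := sqr_ge0 (enorm (x - p)); lra.
Qed.

End Convex.

(** * The minimal time function and its subgradients *)

Section MinTime.
Context {R : realType} {m : nat}.
Implicit Types (x y u v w p : 'rV[R]_m) (A F Q : set 'rV[R]_m).

Lemma translate_dilateP F x w t :
  translate x (dilate t F) w <-> exists2 u, F u & w = x + t *: u.
Proof.
split=> [[_ [u Fu <-] <-]|[u Fu ->]]; first by exists u.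
by exists (t *: u) => //; exists u.
Qed.

Lemma min_time_le F Q x w t : 0 <= t -> Q w -> translate x (dilate t F) w ->
  min_time F Q x <= t.
Proof.
move=> t0 Qw xw; apply: ge_inf; first by exists 0 => s [].
by split => //; exists w.
Qed.

Lemma min_time_ge0 F Q x : 0 <= min_time F Q x.
Proof.
have [E0|/set0P E0] := eqVneq [set t : R | 0 <= t /\
    Q `&` translate x (dilate t F) !=set0] set0.
  by rewrite /min_time E0 inf0.
by apply: lb_le_inf => // t [].
Qed.

Lemma min_time_eq0 F Q x : F 0 -> Q x -> min_time F Q x = 0.
Proof.
move=> F0 Qx; apply/eqP; rewrite eq_le min_time_ge0 andbT.
apply: (min_time_le (lexx _) Qx); apply/translate_dilateP.
by exists 0 => //; rewrite scaler0 addr0.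
Qed.

(** Makes the sets whose infima define the minimal time and the gauge nonempty,
    and provides the Lipschitz constant of the minimal time. *)
Lemma interior_dilate_cover F : F° 0 ->
  exists2 c : R, 0 <= c & forall u, dilate (c * enorm u) F u.
Proof.
move=> /nbhs_ballP[r /= r0 rF]; exists (2 / r); first by rewrite divr_ge0// ltW.
move=> u; have cr : 0 < 2 / r by rewrite divr_gt0.
have [u0|u0] := eqVneq (enorm u) 0.
  have -> : u = 0.
    by apply/normr0_eq0/eqP; rewrite eq_le normr_ge0 andbT -u0 norm_le_enorm.
  by exists 0; [apply: rF; exact: ballxx|rewrite scaler0].
have s0 : 0 < 2 / r * enorm u by rewrite mulr_gt0// lt_neqAle eq_sym u0 enorm_ge0.
(* The factor 2 puts the rescaled vector strictly inside the ball. *)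
exists ((2 / r * enorm u)^-1 *: u); last by rewrite scalerA divff ?scale1r ?gt_eqF.
apply: rF; rewrite -ball_normE /ball_/= sub0r normrN normrZ gtr0_norm ?invr_gt0//.
rewrite mulrC ltr_pdivrMr// (le_lt_trans (norm_le_enorm u))//.
rewrite mulrA [r * _]mulrC divfK ?gt_eqF// ltr_pMl ?ltr1n//.
by rewrite lt_neqAle eq_sym u0 enorm_ge0.
Qed.

(** From [x], go first to [y] and then from [y] to [Q]: by convexity of [F]
    the two displacements, feasible in times [s] and [t], compose to one
    feasible in time [s + t]. *)
Lemma min_time_lipschitz F Q : convex_set F -> F° 0 -> Q !=set0 ->
  exists2 c : R, 0 <= c &
    forall x y, `|min_time F Q x - min_time F Q y| <= c * enorm (x - y).
Proof.
move=> cF /interior_dilate_cover[c c0 cov] [w Qw]; exists c => //.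
suff h x y : min_time F Q x - min_time F Q y <= c * enorm (x - y).
  by move=> x y; rewrite ler_norml h lerNl opprB enorm_distC h.
rewrite lerBlDr -lerBlDl; apply: lb_le_inf.
  exists (c * enorm (w - y)); split; first by rewrite mulr_ge0// enorm_ge0.
  exists w; split => //; exists (w - y); first exact: cov.
  by rewrite subrKC.
move=> t [t0 [z [Qz /translate_dilateP[f Ff zE]]]].
have [g Fg gE] := cov (y - x).
have s0 : 0 <= c * enorm (y - x) by rewrite mulr_ge0// enorm_ge0.
have [k Fk kE] := convex_set_combine cF Fg Ff s0 t0.
rewrite lerBlDl enorm_distC; apply: (min_time_le _ Qz); first exact: addr_ge0.
apply/translate_dilateP; exists k => //.
by rewrite -kE gE addrA subrKC.
Qed.

Lemma total_time_lipschitz F n (Om : 'I_n -> set 'rV[R]_m) :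
  convex_set F -> F° 0 -> (forall i, Om i !=set0) ->
  exists L, is_lipschitz_const L (total_time F Om).
Proof.
move=> cF F0 Om0.
have /choice[c cP] i : exists c, 0 <= c /\
    forall x y, `|min_time F (Om i) x - min_time F (Om i) y| <= c * enorm (x - y).
  by have [c c0 cP] := min_time_lipschitz cF F0 (Om0 i); exists c.
exists (\sum_i c i); split; first by apply: sumr_ge0 => i _; have [] := cP i.
move=> x y; rewrite /total_time -sumrB mulr_suml (le_trans (ler_norm_sum _ _ _))//.
by apply: ler_sum => i _; have [] := cP i.
Qed.

Lemma gauge_fun_le F u t : 0 <= t -> dilate t F u -> gauge_fun F u <= t.
Proof. by move=> t0 tu; apply: ge_inf => //; exists 0 => s []. Qed.

Lemma min_time_le_gauge F Q x w : F° 0 -> Q w ->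
  min_time F Q x <= gauge_fun F (w - x).
Proof.
move=> /interior_dilate_cover[c c0 cov] Qw; apply: lb_le_inf.
  exists (c * enorm (w - x)); split; last exact: cov.
  by rewrite mulr_ge0// enorm_ge0.
move=> t [t0 tF]; apply: (min_time_le t0 Qw).
by exists (w - x) => //; rewrite subrKC.
Qed.

(** Both parts of the choice of [q] are used at the point [p] of [Q] reached
    from [y]: the gauge subgradient bounds the travel time from below, and
    normality discards the term [<q, p - w>]. *)
Lemma admissible_subdiff F Q x q : F° 0 -> Q !=set0 ->
  admissible F Q x q -> subdiff (min_time F Q) x q.
Proof.
move=> F0 [z Qz] [qN qQ] y.
have [Qx|nQx] := pselect (Q x).
  by rewrite qQ// dot0v (min_time_eq0 _ Qx) ?subr0 ?min_time_ge0//; exact: interior_subset.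
have [w [[Qw _] [[v /= vw vq] qw]]] := qN nQx.
rewrite -vq in qw *.
rewrite lerBrDr; apply: lb_le_inf.
  have [c c0 cov] := interior_dilate_cover F0.
  exists (c * enorm (z - y)); split; first by rewrite mulr_ge0// enorm_ge0.
  by exists z; split => //; exists (z - y); [exact: cov|rewrite subrKC].
move=> t [t0 [p [Qp [u tu pE]]]].
have := vw u; have := qw _ Qp; have := gauge_fun_le t0 tu.
have := min_time_le_gauge x F0 Qw.
(* [u] is the displacement from [y] to [p]. *)
have -> : dotv v (u - (w - x)) = dotv v (p - w) - dotv v (y - x).
  by rewrite -pE -dotvNr -dotvDr; congr dotv; apply/rowP => i; rewrite !mxE; ring.
rewrite !dotvNl; lra.
Qed.

Lemma subdiff_sum n (f : 'I_n -> 'rV[R]_m -> R) (q : 'I_n -> 'rV[R]_m) x :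
  (forall i, subdiff (f i) x (q i)) ->
  subdiff (fun y => \sum_i f i y) x (\sum_i q i).
Proof.
move=> fq y; rewrite dotv_suml -sumrB; apply: ler_sum => i _; exact: fq.
Qed.

(** Test the subgradient inequality in the direction of [q] itself. *)
Lemma subdiff_enorm_le (f : 'rV[R]_m -> R) L x q :
  is_lipschitz_const L f -> subdiff f x q -> enorm q <= L.
Proof.
move=> [L0 Lf] /(_ (x + q)); rewrite [_ - x]addrC addKr -sqr_enorm => h.
have := le_trans h (le_trans (ler_norm _) (Lf _ _)).
rewrite [_ - x]addrC addKr expr2.
have [->//|q0] := eqVneq (enorm q) 0.
by rewrite ler_pM2r// lt_neqAle eq_sym q0 enorm_ge0.
Qed.

Lemma is_lipschitz_const_continuous (f : 'rV[R]_m -> R) L :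
  is_lipschitz_const L f -> continuous f.
Proof.
move=> [L0 Lf] x; apply/(@cvgrPdist_le _ _ _ (nbhs x)) => e e0.
have C0 : 0 <= L * Num.sqrt m%:R by rewrite mulr_ge0 ?sqrtr_ge0.
have C1 : 0 < L * Num.sqrt m%:R + 1 by lra.
apply/nbhs_ballP; exists (e / (L * Num.sqrt m%:R + 1)); first exact: divr_gt0.
move=> y; rewrite -ball_normE /ball_/= ltr_pdivlMr// => /ltW.
apply: le_trans; apply: (le_trans (Lf _ _)).
apply: (le_trans (ler_wpM2l L0 (enorm_le_norm _))).
by rewrite mulrA [leRHS]mulrC ler_wpM2r// lerDl.
Qed.

End MinTime.

(** * Partial sums of the step sizes *)

Section StepSizes.
Context {R : realType} (a : nat -> R).
Hypothesis a_ge0 : forall k, (1 <= k)%N -> 0 <= a k.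

Lemma nneseries_le_bound M : (forall k, \sum_(1 <= i < k) a i <= M) ->
  (\sum_(1 <= k <oo) (a k)%:E <= M%:E)%E.
Proof.
move=> aM; apply: lime_le; first by apply: is_cvg_nneseries => k k1 _; rewrite lee_fin a_ge0.
by apply: nearW => k; rewrite sumEFin lee_fin.
Qed.

Lemma divergent_partial_sums N M : (1 <= N)%N ->
  (\sum_(1 <= k <oo) (a k)%:E = +oo)%E ->
  exists2 k, (N <= k)%N & M < \sum_(N <= i < k) a i.
Proof.
move=> N1 ainf; apply: contrapT => h.
(* The maximum with [0] covers the indices [k < N], whose partial sums are at
   most the one up to [N], in case [M] is negative. *)
suff : (\sum_(1 <= k <oo) (a k)%:E <= (\sum_(1 <= i < N) a i + Num.max M 0)%:E)%E.
  by rewrite ainf leye_eq.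
apply: nneseries_le_bound => k.
have [kN|/ltnW Nk] := leqP N k; last first.
  have [k1|] := leqP 1 k; last first.
    rewrite ltnS leqn0 => /eqP ->; rewrite big_geq//.
    apply: addr_ge0; last by rewrite le_max lexx orbT.
    by rewrite big_nat; apply: sumr_ge0 => i /andP[/a_ge0].
  rewrite [in leRHS](big_cat_nat k1 Nk)//= -addrA lerDl.
  apply: addr_ge0; last by rewrite le_max lexx orbT.
  rewrite big_nat; apply: sumr_ge0 => i /andP[ki _]; apply: a_ge0.
  exact: leq_trans ki.
rewrite (big_cat_nat N1 kN)//= lerD2l le_max; apply/orP; left.
by rewrite leNgt; apply/negP => Mk; apply: h; exists k.
Qed.

Lemma convergent_partial_sums : (\sum_(1 <= k <oo) (a k)%:E < +oo)%E ->
  exists M, forall k, \sum_(1 <= i < k) a i <= M.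
Proof.
set s := (\sum_(1 <= k <oo) _)%E => soo.
exists (fine s) => k; rewrite -lee_fin fineK.
  by rewrite -sumEFin; apply: nneseries_lim_ge => i i1 _; rewrite lee_fin a_ge0.
rewrite ge0_fin_numE//; apply: nneseries_ge0 => i i1 _; rewrite lee_fin a_ge0//.
Qed.

Lemma convergent_tail e : 0 < e -> (\sum_(1 <= k <oo) (a k)%:E < +oo)%E ->
  exists2 N, (1 <= N)%N & forall k, (N <= k)%N -> \sum_(N <= i < k) a i <= e.
Proof.
move=> e0 /convergent_partial_sums[M aM].
pose E := [set \sum_(1 <= i < k) a i | k in [set k | (1 <= k)%N]].
have supE : has_sup E.
  split; first by exists (\sum_(1 <= i < 1) a i), 1%N.
  by exists M => _ [k _ <-].
have [_ [N /= N1 <-] hN] := sup_adherent e0 supE.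
exists N => // k Nk; have : E (\sum_(1 <= i < k) a i).
  by exists k => //=; exact: leq_trans Nk.
move=> /(ub_le_sup supE.2); rewrite (big_cat_nat _ Nk)//=; lra.
Qed.

End StepSizes.

(** * The projected subgradient method *)

Section ProjectedSubgradient.
Context {R : realType} {m : nat} (T : 'rV[R]_m -> R) (C : set 'rV[R]_m).
Context (L : R) (alpha : nat -> R) (x g : nat -> 'rV[R]_m).
Hypothesis T_lip : is_lipschitz_const L T.
Hypotheses (C_neq0 : C !=set0) (C_closed : closed C) (C_convex : convex_set C).
Hypothesis alpha_gt0 : forall k, (1 <= k)%N -> 0 < alpha k.
Hypothesis x1C : C (x 1%N).
Hypothesis g_subgradient : forall k, (1 <= k)%N -> subdiff T (x k) (g k).
Hypothesis x_step : forall k, (1 <= k)%N ->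
  x k.+1 = eproj (x k - alpha k *: g k) C.

Lemma iterate_mem k : (1 <= k)%N -> C (x k).
Proof.
case: k => // -[//|k] _; rewrite x_step//.
by have [] := eprojP (x k.+1 - alpha k.+1 *: g k.+1) C_neq0 C_closed.
Qed.

(** Expand [|x_k - alpha_k g_k - y|^2], which dominates [|x_{k+1} - y|^2] since
    projection does not increase distances to [C]. *)
Lemma subgradient_step k y : (1 <= k)%N -> C y ->
  enorm (x k.+1 - y) ^+ 2 + 2 * (alpha k * (T (x k) - T y)) <=
  enorm (x k - y) ^+ 2 + L ^+ 2 * alpha k ^+ 2.
Proof.
move=> k1 Cy; rewrite x_step//.
have := eproj_contract (x k - alpha k *: g k) C_neq0 C_closed C_convex Cy.
rewrite addrAC -scaleNr (sqr_enormD (x k - y)) (sqr_enorm (_ *: _)) !(dotvZl, dotvZr).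
rewrite -sqr_enorm (dotvC _ (g k)).
have a0 := alpha_gt0 k1.
have := g_subgradient k1 y; rewrite -opprB dotvNr => /(ler_wpM2l (ltW a0)).
have gL : enorm (g k) ^+ 2 <= L ^+ 2.
  rewrite ler_pXn2r ?nnegrE ?enorm_ge0//; last by case: T_lip.
  exact: subdiff_enorm_le (g_subgradient k1).
have := ler_wpM2l (sqr_ge0 (alpha k)) gL.
lra.
Qed.

(** The starting index [N] is arbitrary because the convergence of the iterates
    rests on tails, where the sum of the squared steps is small. *)
Lemma subgradient_sum N k y : (1 <= N <= k)%N -> C y ->
  enorm (x k - y) ^+ 2 + 2 * \sum_(N <= i < k) alpha i * (T (x i) - T y) <=
  enorm (x N - y) ^+ 2 + L ^+ 2 * \sum_(N <= i < k) alpha i ^+ 2.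
Proof.
move=> /andP[N1 Nk] Cy; elim: k Nk => [|k ih].
  by rewrite leqn0 => /eqP N0; rewrite N0 in N1.
rewrite leq_eqVlt => /predU1P[<-|]; first by rewrite !big_geq// !mulr0.
rewrite ltnS => Nk; rewrite !big_nat_recr//=.
have := ih Nk; have := subgradient_step (leq_trans N1 Nk) Cy; lra.
Qed.

Lemma best_value_le j k : (1 <= j <= k)%N -> best_value T x k <= T (x j).
Proof.
move=> jk; apply: (bigmin_inf_seq _ j) => //.
by rewrite mem_index_iota ltnS.
Qed.

Lemma le_best_value k v : (forall j, (1 <= j)%N -> v <= T (x j)) ->
  v <= best_value T x k.
Proof.
move=> vT; rewrite /best_value big_nat.
by elim/big_ind : _ => [|u w vu vw|i /andP[i1 _]];
  [exact: vT|rewrite le_min vu vw|exact: vT].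
Qed.

(** Replace every [T (x i)] in [subgradient_sum] by the smaller best value. *)
Lemma best_value_rate k y : (1 <= k)%N -> C y ->
  2 * (best_value T x k - T y) * \sum_(1 <= i < k.+1) alpha i <=
  enorm (x 1%N - y) ^+ 2 + L ^+ 2 * \sum_(1 <= i < k.+1) alpha i ^+ 2.
Proof.
move=> k1 Cy; have k2 : (1 <= 1 <= k.+1)%N by [].
apply: le_trans (subgradient_sum k2 Cy).
rewrite -mulrA ler_wpDl ?sqr_ge0// ler_wpM2l// mulr_sumr.
rewrite big_nat [leRHS]big_nat; apply: ler_sum => i /andP[i1 ik].
rewrite mulrC; apply: ler_wpM2l; first exact/ltW/alpha_gt0.
by rewrite lerD2r best_value_le// i1.
Qed.

Let S := minimizers T C.
Hypothesis S_neq0 : S !=set0.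
Hypothesis alpha_sum : (\sum_(1 <= k <oo) (alpha k)%:E = +oo)%E.
Hypothesis alpha_sqr_sum : (\sum_(1 <= k <oo) (alpha k ^+ 2)%:E < +oo)%E.

Lemma minimizer_value s : S s -> optimal_value T C = T s.
Proof.
move=> [Cs smin]; apply/eqP; rewrite eq_le; apply/andP; split.
  by apply: ge_inf; [exists (T s) => _ [y Cy <-]; exact: smin|exists s].
by apply: lb_le_inf => [|_ [y Cy <-]]; [exists (T s), s|exact: smin].
Qed.

(** Otherwise the left side of [subgradient_sum] at a minimizer would exceed
    [2 e] times a divergent sum, while the right side stays bounded. *)
Lemma frequently_near_optimal e N : 0 < e -> (1 <= N)%N ->
  exists2 k, (N <= k)%N & T (x k) < optimal_value T C + e.
Proof.
move=> e0 N1; have [s Ss] := S_neq0; have [Cs _] := Ss.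
rewrite (minimizer_value Ss); apply: contrapT => h.
have hT k : (N <= k)%N -> e <= T (x k) - T s.
  move=> Nk; rewrite leNgt; apply/negP => Tk; apply: h; exists k => //; lra.
have [B hB] := convergent_partial_sums (fun k _ => sqr_ge0 (alpha k)) alpha_sqr_sum.
pose D := enorm (x N - s) ^+ 2 + L ^+ 2 * B.
have [k Nk Mk] := divergent_partial_sums (fun k k1 => ltW (alpha_gt0 k1))
  (D / (2 * e)) N1 alpha_sum.
have Nk' : (1 <= N <= k)%N by rewrite N1.
have := subgradient_sum Nk' Cs.
have : \sum_(N <= i < k) alpha i ^+ 2 <= B.
  apply: le_trans (hB k); rewrite [leRHS](big_cat_nat N1 Nk)//= lerDr.
  by apply: sumr_ge0 => i _; exact: sqr_ge0.
move=> /(ler_wpM2l (sqr_ge0 L)).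
have : e * \sum_(N <= i < k) alpha i <= \sum_(N <= i < k) alpha i * (T (x i) - T s).
  rewrite mulr_sumr big_nat [leRHS]big_nat; apply: ler_sum => i /andP[Ni _].
  by rewrite mulrC ler_wpM2l ?hT// ltW// alpha_gt0// (leq_trans N1).
move: Mk; rewrite ltr_pdivrMr; last by rewrite mulr_gt0.
have := sqr_ge0 (enorm (x k - s)); rewrite /D; lra.
Qed.

(** Best values never increase, so one iterate within [e] of the optimal value
    controls all later ones. *)
Lemma best_value_cvg : best_value T x @ \oo --> optimal_value T C.
Proof.
have [s Ss] := S_neq0; have [Cs smin] := Ss.
apply/cvgrPdist_lt => e e0.
have [k k1 Tk] := frequently_near_optimal e0 (leqnn 1).
exists k => // n /= kn; rewrite distrC ger0_norm; last first.
  by rewrite subr_ge0 (minimizer_value Ss) le_best_value// => j j1; exact/smin/iterate_mem.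
have kn' : (1 <= k <= n)%N by rewrite k1.
have := best_value_le kn'; lra.
Qed.

(** Along indices [u j] with values tending to the optimal value, the iterates
    stay in a bounded closed part of [C], hence cluster at some point of [C],
    which is optimal by continuity of [T]. *)
Lemma minimizer_cluster : exists2 p, S p &
  forall e N, 0 < e -> exists2 k, (N <= k)%N & enorm (x k - p) < e.
Proof.
have [s Ss] := S_neq0; have [Cs smin] := Ss.
have /choice[u uP] j : exists k, (j < k)%N /\ T (x k) < optimal_value T C + j.+1%:R^-1.
  have [|k jk Tk] := @frequently_near_optimal j.+1%:R^-1 j.+1 _ isT.
    by rewrite invr_gt0.
  by exists k.
have u1 j : (1 <= u j)%N by have [] := uP j; case: (u j).
have [B hB] := convergent_partial_sums (fun k _ => sqr_ge0 (alpha k)) alpha_sqr_sum.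
pose D := enorm (x 1%N - s) ^+ 2 + L ^+ 2 * B.
have xD k : (1 <= k)%N -> enorm (x k - s) ^+ 2 <= D.
  move=> k1; have k1' : (1 <= 1 <= k)%N by [].
  have := subgradient_sum k1' Cs; have := ler_wpM2l (sqr_ge0 L) (hB k).
  suff : 0 <= \sum_(1 <= i < k) alpha i * (T (x i) - T s) by rewrite /D; lra.
  rewrite big_nat; apply: sumr_ge0 => i /andP[i1 _].
  by rewrite mulr_ge0 ?subr_ge0 ?smin//; [exact/ltW/alpha_gt0|exact: iterate_mem].
have cK := @compact_closed_eball _ _ C s (Num.sqrt D) C_closed.
have [|p [[Cp _] pcl]] := cK ((x \o u) @ \oo) _ _.
- exists 0%N => // j _ /=; split; first exact: iterate_mem.
  by rewrite /= enorm_distC -[leLHS]ger0_norm ?enorm_ge0// -sqrtr_sqr ler_wsqrtr// xD.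
have Tp : T p <= optimal_value T C.
  rewrite leNgt; apply/negP => Vp.
  pose e := (T p - optimal_value T C) / 2.
  have e0 : 0 < e by rewrite /e; lra.
  have [||y [/= yV yp]] := pcl [set y | T y < optimal_value T C + e]
      [set y | `|T p - T y| < e].
  - have [N _ hN] := near_infty_natSinv_lt (PosNum e0).
    exists N => // j /hN /= je; have [_ Tj] := uP j.
    by apply: (lt_trans Tj); rewrite ltrD2l.
  - have := @is_lipschitz_const_continuous _ _ T L T_lip p.
    by move=> /(@cvgrPdist_lt _ _ _ (nbhs p)) /(_ _ e0).
  have := ler_norm (T p - T y); rewrite /e in yV yp *; lra.
exists p.
  split=> // y Cy; apply: (le_trans Tp).
  by rewrite (minimizer_value Ss) smin.
move=> e N e0.
have [||y [/= [k Nk <-] kp]] := pcl [set x k | k in [set k | (N <= k)%N]]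
    [set y | enorm (y - p) < e].
- exists N => // j /= Nj; exists (u j) => //=.
  by have [ju _] := uP j; exact: leq_trans (ltnW ju).
- have := @continuous_enorm_dist _ _ p p.
  move=> /(@cvgrPdist_lt _ _ _ (nbhs p)) /(_ _ e0).
  apply: filterS => y; rewrite subrr -[X in X - _]/(enorm 0).
  rewrite [enorm 0](_ : _ = 0) ?sub0r ?normrN; last by rewrite /enorm dot0v sqrtr0.
  by rewrite ger0_norm ?enorm_ge0// enorm_distC.
by exists k.
Qed.

(** Once an iterate of late index [k] is close to the cluster point [p], all
    later ones are: the squared distance grows at most by the tail of the
    series of squared steps. *)
Lemma iterate_cvg : exists2 p, S p & x @ \oo --> p.
Proof.
have [p Sp pfreq] := minimizer_cluster; exists p => //.
have [Cp pmin] := Sp.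
apply/cvgrPdist_lt => e e0.
have e2 : 0 < e ^+ 2 / 2 by rewrite divr_gt0// exprn_gt0.
(* Adding [1] keeps the divisor positive when [L = 0]. *)
have L1 : 0 < L ^+ 2 + 1 by rewrite ltr_wpDl ?sqr_ge0.
have [N N1 tailN] := convergent_tail (fun k _ => sqr_ge0 (alpha k))
  (divr_gt0 e2 L1) alpha_sqr_sum.
have [k Nk kp] := pfreq (Num.sqrt (e ^+ 2 / 2)) N (etrans (sqrtr_gt0 _) e2).
exists k => // n /= kn.
apply: le_lt_trans (norm_le_enorm _) _; rewrite enorm_distC.
rewrite -(@ltr_pXn2r _ 2)// ?nnegrE ?enorm_ge0 ?(ltW e0)//.
have kn' : (1 <= k <= n)%N by rewrite (leq_trans N1).
have := subgradient_sum kn' Cp.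
have : 0 <= \sum_(k <= i < n) alpha i * (T (x i) - T p).
  rewrite big_nat; apply: sumr_ge0 => i /andP[ki _].
  have i1 : (1 <= i)%N by rewrite (leq_trans N1)// (leq_trans Nk).
  by rewrite mulr_ge0 ?subr_ge0 ?pmin//; [exact/ltW/alpha_gt0|exact: iterate_mem].
have : enorm (x k - p) ^+ 2 < e ^+ 2 / 2.
  by rewrite -[ltRHS]sqr_sqrtr ?(ltW e2)// ltr_pXn2r ?nnegrE ?enorm_ge0 ?sqrtr_ge0.
have : L ^+ 2 * \sum_(k <= i < n) alpha i ^+ 2 <= e ^+ 2 / 2.
  have : \sum_(k <= i < n) alpha i ^+ 2 <= e ^+ 2 / 2 / (L ^+ 2 + 1).
    apply: le_trans (tailN _ (leq_trans Nk kn)).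
    rewrite [leRHS](big_cat_nat Nk)//= lerDr.
    by apply: sumr_ge0 => i _; exact: sqr_ge0.
  rewrite ler_pdivlMr// mulrDr mulr1 [X in X + _]mulrC; apply: le_trans.
  by rewrite lerDl; apply: sumr_ge0 => i _; exact: sqr_ge0.
lra.
Qed.

(** [best_value_rate] bounds the same quantity by [|x_1 - s|^2] for each
    minimizer [s]; square roots are taken so that the infimum over [s] may
    pass inside the square. *)
Lemma best_value_dist_rate k : (1 <= k)%N ->
  best_value T x k - optimal_value T C <=
    (dist_to (x 1%N) S ^+ 2 + L ^+ 2 * \sum_(1 <= i < k.+1) alpha i ^+ 2)
    / (2 * \sum_(1 <= i < k.+1) alpha i).
Proof.
move=> k1; set A := \sum_(1 <= i < k.+1) alpha i.
set B := L ^+ 2 * _.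
have A0 : 0 < A.
  rewrite /A big_nat_recr//= ltr_wpDl ?alpha_gt0// big_nat.
  by apply: sumr_ge0 => i /andP[i1 _]; exact/ltW/alpha_gt0.
rewrite ler_pdivlMr ?mulr_gt0// -lerBlDr.
set X := _ - B.
have Xs s : S s -> Num.sqrt X <= enorm (x 1%N - s).
  move=> Ss; rewrite -[leRHS]ger0_norm ?enorm_ge0// -sqrtr_sqr ler_wsqrtr//.
  have [Cs _] := Ss; have := best_value_rate k1 Cs.
  by rewrite /X lerBlDr (minimizer_value Ss) mulrA [_ * 2]mulrC.
(* Only for positive [X] does the bound on [sqrt X] carry information. *)
have [X0|/ltW X0] := leP X 0; first exact: le_trans (sqr_ge0 _).
rewrite -[leLHS]sqr_sqrtr// ler_pXn2r ?nnegrE ?sqrtr_ge0//.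
  by apply: lb_le_inf => [|_ [s Ss <-]]; [have [s Ss] := S_neq0; exists (enorm (x 1%N - s)), s|exact: Xs].
apply: lb_le_inf => [|_ [s Ss <-]]; last exact: enorm_ge0.
by have [s Ss] := S_neq0; exists (enorm (x 1%N - s)), s.
Qed.

End ProjectedSubgradient.

(** * Convergence of the algorithm *)

(* Sequences are indexed from 1; their terms of index 0 are irrelevant. *)
Theorem theorem4p1 (R : realType) (m n : nat) (F Omega : set 'rV[R]_m)
    (Om : 'I_n -> set 'rV[R]_m)
    (alpha : nat -> R) (x : nat -> 'rV[R]_m) (q : 'I_n -> nat -> 'rV[R]_m) :
  let T := total_time F Om in
  let S := minimizers T Omega in
  let Vhat := optimal_value T Omega in
  let V := best_value T x in
  closed F -> bounded_set F -> convex_set F -> F° 0 ->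
  (2 <= n)%N ->
  Omega !=set0 -> closed Omega -> convex_set Omega ->
  (forall i, [/\ Om i !=set0, closed (Om i) & convex_set (Om i)]) ->
  S !=set0 ->
  (forall k, (1 <= k)%N -> 0 < alpha k) ->
  Omega (x 1%N) ->
  (forall i k, (1 <= k)%N -> admissible F (Om i) (x k) (q i k)) ->
  (forall k, (1 <= k)%N ->
     x k.+1 = eproj (x k - alpha k *: \sum_(i < n) q i k) Omega) ->
  (\sum_(1 <= k <oo) (alpha k)%:E = +oo)%E ->
  (\sum_(1 <= k <oo) (alpha k ^+ 2)%:E < +oo)%E ->
  [/\ exists2 xbar, S xbar & x @ \oo --> xbar,
      V @ \oo --> Vhat
    & forall L, is_lipschitz_const L T ->
      forall k, (1 <= k)%N ->
        V k - Vhat <=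
          (dist_to (x 1%N) S ^+ 2 + L ^+ 2 * \sum_(1 <= i < k.+1) alpha i ^+ 2)
          / (2 * \sum_(1 <= i < k.+1) alpha i)].
Proof.
move=> T S Vhat V _ _ F_convex F0 _ Omega0 Omega_closed Omega_convex Om_ok S0.
move=> alpha0 x1 q_adm x_step alpha_sum alpha_sqr_sum.
have g_sub k : (1 <= k)%N -> subdiff T (x k) (\sum_i q i k).
  move=> k1; apply: subdiff_sum => i; have [Om0 _ _] := Om_ok i.
  exact: admissible_subdiff F0 Om0 (q_adm i k k1).
have Om0 i : Om i !=set0 by have [] := Om_ok i.
have [L TL] := total_time_lipschitz F_convex F0 Om0.
split; first exact: iterate_cvg TL Omega0 Omega_closed Omega_convex alpha0 x1 g_sub
    x_step S0 alpha_sum alpha_sqr_sum.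
  exact: best_value_cvg TL Omega0 Omega_closed Omega_convex alpha0 x1
    g_sub x_step S0 alpha_sum alpha_sqr_sum.
move=> L' TL' k k1.
exact: (best_value_dist_rate TL' Omega0 Omega_closed Omega_convex alpha0 g_sub
  x_step S0 k1).
Qed.
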